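(* Let $q$ be a prime power and let $k\ge 2$. Then $$\lim_{m+n\to\infty}\frac{P_k(m;n)}{N_k(m)N_k(n)}=1,$$ where $m,n$ range over the nonnegative integers.
   Context: $\mathbb F_q$ is the finite field with $q$ elements. Two polynomials in $\mathbb F_q[x_1,\dots,x_k]$ are identified if they differ by a factor in $\mathbb F_q^\times$; the classes are called normalized polynomials. For an integer $m\ge 0$, $\mathcal N_k(m)$ is the set of normalized (nonzero) polynomials in $\mathbb F_q[x_1,\dots,x_k]$ of total degree $m$, and $N_k(m)=|\mathcal N_k(m)|$. For $m,n\ge 0$, $P_k(m;n)=|\{(f,g)\in\mathcal N_k(m)\times\mathcal N_k(n):\gcd(f,g)=1\}|$. *)

(* Defs.v *)
From HB Require Import structures.
From mathcomp Require Import all_boot all_order all_algebra.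
From mathcomp Require Import finmap mpoly boolp reals.

Set Implicit Arguments.
Unset Strict Implicit.
Unset Printing Implicit Defensive.

Import Order.TTheory GRing.Theory Num.Theory.

Local Open Scope fset_scope.
Local Open Scope ring_scope.

Section NormalizedPolynomials.

Variables (F : finFieldType) (k : nat).

Implicit Types (p f g d e : {mpoly F[k]}) (m n : nat).

(* [msize p] is 1 + the total degree of [p], and 0 for [p = 0]; so
   [msize p == m.+1] says that [p] is nonzero of total degree [m]. *)
Definition polys_of_deg m : {fset {mpoly F[k]}} :=
  let of_coefs (c : {ffun 'X_{1..k < m.+1} -> F}) : {mpoly F[k]} :=
    \sum_(u : 'X_{1..k < m.+1}) c u *: 'X_[u] in
  [fset of_coefs c | c in {ffun 'X_{1..k < m.+1} -> F} & msize (of_coefs c) == m.+1].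

Lemma in_polys_of_deg m p : (p \in polys_of_deg m) = (msize p == m.+1).
Proof.
apply/imfsetP/idP => [[c /= hc ->] //|hp].
have E : p = \sum_(u : 'X_{1..k < m.+1}) p@_u *: 'X_[u].
  by apply: mpolywE; rewrite (eqP hp).
exists [ffun u : 'X_{1..k < m.+1} => p@_u]; last first.
  by rewrite [LHS]E; apply: eq_bigr => u _; rewrite ffunE.
rewrite inE /= (_ : \sum_u _ = p) ?hp //.
by rewrite [RHS]E; apply: eq_bigr => u _; rewrite ffunE.
Qed.

(* A normalized polynomial is the class of a nonzero polynomial modulo
   multiplication by nonzero constants. *)
Definition normclass p : {fset {mpoly F[k]}} :=
  [fset a *: p | a in F & a != 0].

Lemma in_normclass p f :
  reflect (exists2 a : F, a != 0 & f = a *: p) (f \in normclass p).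
Proof. by apply: (iffP (imfsetP _ _ _ _)) => -[a a0 ->]; exists a. Qed.

Definition normpolys m : {fset {fset {mpoly F[k]}}} :=
  [fset normclass p | p in polys_of_deg m].

Definition Npoly m : nat := #|` normpolys m|.

Definition mdivides d f : Prop := exists h, f = h * d.

Definition is_mgcd d f g : Prop :=
  [/\ mdivides d f, mdivides d g
    & forall e, mdivides e f -> mdivides e g -> mdivides e d].

(* The condition gcd(f, g) = 1 does not depend on the representatives;
   it is required here for all of them. *)
Definition coprime_classes (C D : {fset {mpoly F[k]}}) : Prop :=
  forall f g, f \in C -> g \in D -> is_mgcd 1 f g.

Definition Pcoprime m n : nat :=
  #|` [fset CD in normpolys m `*` normpolys n | `[< coprime_classes CD.1 CD.2 >]]|.

End NormalizedPolynomials.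

(* Main.v *)
(* If f and g have a common divisor that does not divide 1, then they have one
   of some degree d with 1 <= d <= min(m, n); so, with Q(j) the number of
   polynomials of degree j, the number of non-coprime pairs of classes is at most
   the sum over d of Q(d) Q(m - d) Q(n - d); no gcd theory is needed. Let D(j) be
   the number of monomials of degree at most j. Then q^D(j) / 2 <= Q(j) <= q^D(j),
   and for k >= 2
     D(d) + D(m - d) <= D(m) + 1  and  D(n - d) + n + d <= D(n),
   so the d-th term is at most q^(1 - n - d) q^(D(m) + D(n)). The terms being
   geometric in d, the proportion of non-coprime pairs is at most
   4 q^3 / q^max(m, n). *)

Require Import Defs.
From HB Require Import structures.
From mathcomp Require Import all_boot all_order all_algebra.
From mathcomp Require Import finmap mpoly boolp reals.
From mathcomp Require Import zify ring.

Import Order.TTheory GRing.Theory Num.Theory.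

Local Open Scope fset_scope.
Local Open Scope ring_scope.

Set Implicit Arguments.
Unset Strict Implicit.
Unset Printing Implicit Defensive.

(** * Cardinalities of products, complements and unions of finite sets *)

Lemma card_fsetM (K K' : choiceType) (A : {fset K}) (B : {fset K'}) :
  #|` (A `*` B)%fset| = (#|` A| * #|` B|)%N.
Proof.
have -> : (#|` A| * #|` B|)%N = size [seq (x, y) | x <- A, y <- B].
  by rewrite size_allpairs.
apply/perm_size/uniq_perm => //.
  apply: allpairs_uniq; rewrite ?fset_uniq //.
  by move=> [a b] [c d] _ _ [-> ->].
move=> [x y]; rewrite in_fsetM /=; apply/andP/allpairsP => [[xA yB]|].
  by exists (x, y).
by case=> -[a b] /= [aA bB [-> ->]].
Qed.

Lemma cardfs_predC (K : choiceType) (A : {fset K}) (P : pred K) :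
  (#|` [fset x in A | P x]| + #|` [fset x in A | ~~ P x]| = #|` A|)%N.
Proof.
rewrite -(cardfsID [fset x in A | P x] A); congr addn; congr (#|` _|).
  by apply/fsetP => x; rewrite !inE andbA andbb.
by apply/fsetP => x; rewrite !inE; case: (x \in A); rewrite ?andbT ?andbF.
Qed.

Lemma leq_card_bigfcup (K : choiceType) (I : Type) (r : seq I) (A : I -> {fset K}) :
  (#|` (\bigcup_(i <- r) A i)%fset| <= \sum_(i <- r) #|` A i|)%N.
Proof.
elim/big_ind2: _ => [|B a C b hB hC|//]; first by rewrite cardfs0.
by apply: leq_trans (leq_card_fsetU _ _) (leq_add hB hC).
Qed.

(** * Monomials of bounded degree *)

Section MonomialCount.

Variable n : nat.

(** The function D of the overview for [n.+1] variables; the summand counts the monomials of degree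
    exactly [i]. *)
Definition nmonom d := (\sum_(i < d.+1) 'C(i + n, i))%N.

Lemma card_bmultinom d : #|{: 'X_{1..n.+1 < d.+1}}| = nmonom d.
Proof.
rewrite -sum1_card (partition_big (fun u : 'X_{1..n.+1 < d.+1} =>
  Ordinal (bmdeg u)) xpredT) //=.
apply: eq_bigr => i _; rewrite sum1_card -size_basis.
rewrite cardE -(size_map val); apply/perm_size/uniq_perm.
- by rewrite (map_inj_uniq val_inj) enum_uniq.
- exact: uniq_basis.
move=> u; rewrite -basis_cover; apply/mapP/eqP => [[v + ->]|ui].
  by rewrite mem_enum => /eqP <-.
have ud : (mdeg u < d.+1)%N by rewrite ui ltn_ord.
by exists (BMultinom ud) => //; rewrite mem_enum; apply/eqP.
Qed.

Lemma nmonomD d e :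
  nmonom (d + e) = (nmonom e + \sum_(i < d) 'C(e.+1 + i + n, e.+1 + i))%N.
Proof. by rewrite /nmonom -addnS addnC big_split_ord. Qed.

Lemma leq_bin_diag i j : (i <= j)%N -> ('C(i + n, i) <= 'C(j + n, j))%N.
Proof.
move=> ij; have E k : 'C(k + n, k) = 'C(k + n, n).
  by rewrite -[in RHS]bin_sub ?leq_addl // addnK.
by rewrite !E leq_bin2l // leq_add2r.
Qed.

(** The degrees 1 to [d] in [nmonom d] are matched with the degrees [e + 1] to [e + d]; the constant
    monomial stays unmatched, hence the successor. *)
Lemma nmonom_superadd d e : (nmonom d + nmonom e <= (nmonom (d + e)).+1)%N.
Proof.
rewrite nmonomD /nmonom [X in (X + _)%N]big_ord_recl /= bin0.
rewrite add1n addSn ltnS addnC leq_add2l.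
apply: leq_sum => i _; apply: leq_bin_diag.
by rewrite /bump /= add1n addSn ltnS leq_addl.
Qed.

(** In at least two variables there are more than [i] monomials of degree [i]; this is summed over
    the degrees [e + 1] to [e + d]. *)
Lemma nmonom_growth d e : (0 < n)%N -> (0 < d)%N ->
  (nmonom e + (d + e) + d <= nmonom (d + e))%N.
Proof.
move=> n0 d0; have lin i : (i < 'C(i + n, i))%N.
  by rewrite -{1}(binSn i) -addn1 leq_bin2l // leq_add2l.
rewrite nmonomD -addnA leq_add2l; case: d d0 => // d _.
elim: d => [|d IH]; first by rewrite big_ord1 /=; have := lin (e.+1 + 0)%N; lia.
rewrite big_ord_recr /=; apply: leq_trans (leq_add IH (lin (e.+1 + d.+1)%N)); lia.
Qed.

End MonomialCount.

(** * Numbers of polynomials and of their classes *)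

Section Counting.

Variables (F : finFieldType) (k : nat).
Local Notation q := #|F|.

Let of_coefs m (c : {ffun 'X_{1..k < m.+1} -> F}) : {mpoly F[k]} :=
  \sum_(u : 'X_{1..k < m.+1}) c u *: 'X_[u].

Let coef_of m (c : {ffun 'X_{1..k < m.+1} -> F}) (u : 'X_{1..k < m.+1}) :
  (of_coefs c)@_u = c u.
Proof.
rewrite raddf_sum (bigD1 u) //= mcoeffZ mcoeffX eqxx mulr1 big1 ?addr0 //.
by move=> v vu; rewrite mcoeffZ mcoeffX -bmeqP (negPf vu) mulr0.
Qed.

Let of_coefs_inj m : injective (@of_coefs m).
Proof. by move=> c d e; apply/ffunP => u; rewrite -!coef_of e. Qed.

Let msize_of m (c : {ffun 'X_{1..k < m.+1} -> F}) : (msize (of_coefs c) <= m.+1)%N.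
Proof.
apply: leq_trans (msize_sum _ _ _) _; apply/bigmax_leqP => u _.
by apply: leq_trans (msizeZ_le _ _) _; rewrite msizeX ltnS -ltnS bmdeg.
Qed.

Lemma card_polys_of_deg_le m :
  (#|` polys_of_deg F k m| <= q ^ #|{: 'X_{1..k < m.+1}}|)%N.
Proof.
rewrite -card_ffun /polys_of_deg /=; apply: leq_trans (leq_imfset_card _ _ _) _.
rewrite cardE; apply: uniq_leq_size (enum_finmem_uniq _) _ => c _.
by rewrite mem_enum.
Qed.

(* Adding a fixed monomial of degree m maps injectively the polynomials of
   degree < m to polynomials of degree m. *)
Lemma card_polys_of_deg_ge m : (0 < k)%N ->
  (q ^ #|{: 'X_{1..k < m.+1}}| <= 2 * #|` polys_of_deg F k m|)%N.
Proof.
move=> k0; pose u0 : 'X_{1..k} := (U_(Ordinal k0) *+ m)%MM.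
have du0 : mdeg u0 = m by rewrite mdegMn mdeg1 mul1n.
have lu0 : (mdeg u0 < m.+1)%N by rewrite du0.
pose u : 'X_{1..k < m.+1} := BMultinom lu0.
pose A := [pred c : {ffun 'X_{1..k < m.+1} -> F} | msize (of_coefs c) == m.+1].
have -> : #|` polys_of_deg F k m| = #|A|.
  rewrite card_imfset; last exact: of_coefs_inj.
  rewrite cardE; apply/perm_size; apply: uniq_perm => [||c].
  - exact: enum_finmem_uniq.
  - exact: enum_uniq.
  by rewrite enum_finmemE mem_enum.
(* It remains to inject the complement of [A], the polynomials of degree below [m], into [A]. *)
rewrite -card_ffun -(cardC A) mul2n -addnn leq_add2l.
pose sh (c : {ffun 'X_{1..k < m.+1} -> F}) := [ffun v => c v + (v == u)%:R].
have sh_inj : injective sh.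
  move=> c d /ffunP e; apply/ffunP => v; have := e v; rewrite !ffunE.
  exact: addIr.
rewrite -(card_image sh_inj); apply/subset_leq_card/subsetP => _ /imageP[c cA ->].
rewrite inE eqn_leq msize_of /= -[X in (X < _)%N]du0.
have c0 : c u = 0.
  rewrite -coef_of; apply: memN_msupp_eq0; apply: msize_mdeg_ge.
  rewrite /= du0 -ltnS ltn_neqAle msize_of andbT.
  by move: cA; rewrite !inE.
apply: msize_mdeg_lt; rewrite mcoeff_msupp (coef_of _ u).
by rewrite ffunE eqxx c0 add0r oner_eq0.
Qed.

(** Every polynomial is a scalar multiple of a chosen representative of its class; letting the
    scalar run over all of [F], zero included, costs the factor [q]. *)
Lemma card_polys_of_deg_normpolys m :
  (#|` polys_of_deg F k m| <= q * Npoly F k m)%N.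
Proof.
(* The default 0 is never taken on [normpolys], whose members are nonempty. *)
pose rep (C : {fset {mpoly F[k]}}) : {mpoly F[k]} := head 0 (enum_fset C).
pose all_mul := [fset x.1 *: rep x.2 | x in
  ([fset a in F] `*` normpolys F k m)%fset].
apply: (@leq_trans #|` all_mul|).
  apply/fsubset_leq_card/fsubsetP => p hp.
  have : rep (normclass p) \in normclass p.
    have : p \in normclass p.
      by apply/in_normclass; exists 1; rewrite ?oner_eq0 ?scale1r.
    have hd (s : seq {mpoly F[k]}) : p \in s -> head 0 s \in s.
      by case: s => // a s _; rewrite mem_head.
    exact: hd.
  case/in_normclass => a a0 Ea; apply/imfsetP => /=.
  exists (a^-1, normclass p); last by rewrite /= Ea scalerA mulVf ?scale1r.
  rewrite in_fsetM /=; apply/andP; split; first by rewrite inE.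
  by apply/imfsetP; exists p.
apply: leq_trans (leq_imfset_card _ _ _) _ => /=.
rewrite -[size _]/(#|` _|) card_fsetM; apply: eq_leq; congr (_ * _)%N.
by rewrite card_finset; apply: eq_card.
Qed.

Lemma Npoly_gt0 m : (0 < k)%N -> (0 < Npoly F k m)%N.
Proof.
move=> k0; rewrite lt0n; apply: contraTneq (card_polys_of_deg_ge m k0) => N0.
have := card_polys_of_deg_normpolys m; rewrite N0 muln0 leqn0 => /eqP ->.
by rewrite muln0 -ltnNge expn_gt0 (ltnW (card_finNzRing_gt1 F)).
Qed.

(** * Common factors of non-coprime pairs *)

Lemma mdivides_constant (e p : {mpoly F[k]}) : msize e = 1%N -> mdivides e p.
Proof.
move/eqP/msize_poly1P => [c c0 ->]; exists (c^-1 *: p).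
by rewrite mulrC mul_mpolyC scalerA mulfV ?scale1r.
Qed.

Lemma normclass_scale (a : F) (p : {mpoly F[k]}) :
  a != 0 -> normclass (a *: p) = normclass p.
Proof.
move=> a0; apply/fsetP => f; apply/in_normclass/in_normclass => -[b b0 ->].
  by exists (b * a); rewrite ?mulf_neq0 ?scalerA.
by exists (b / a); rewrite ?scalerA ?mulfVK // mulf_neq0 ?invr_eq0.
Qed.

Definition noncoprime_pairs m n :=
  [fset CD in normpolys F k m `*` normpolys F k n
     | ~~ `[< coprime_classes CD.1 CD.2 >]].

Lemma Pcoprime_compl m n :
  (Pcoprime F k m n + #|` noncoprime_pairs m n| = Npoly F k m * Npoly F k n)%N.
Proof.
rewrite /Npoly -card_fsetM; exact: cardfs_predC.
Qed.

Lemma noncoprime_classesP (C D : {fset {mpoly F[k]}}) m n :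
  C \in normpolys F k m -> D \in normpolys F k n -> ~ coprime_classes C D ->
  exists d f g e, [/\ (0 < d <= minn m n)%N,
    e \in polys_of_deg F k d, f \in polys_of_deg F k (m - d),
    g \in polys_of_deg F k (n - d)
    & (C, D) = (normclass (f * e), normclass (g * e))].
Proof.
move=> /imfsetP[/= p0 p0m ->] /imfsetP[/= r0 r0n ->].
rewrite !in_polys_of_deg in p0m r0n.
move=> /existsNP[p] /existsNP[r] /not_implyP[/in_normclass[a a0 Ep]].
move=> /not_implyP[/in_normclass[b b0 Er]] ncop.
(* Since 1 divides everything, being a gcd can only fail through a common divisor that does not
   divide 1. *)
have [e [[f Ef] [g Eg] e1]] :
    exists e, [/\ mdivides e p, mdivides e r & ~ mdivides e 1].
  apply: contra_notP ncop => noe; split.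
  - by exists p; rewrite mulr1.
  - by exists r; rewrite mulr1.
  move=> e ep er; apply: contrapT => e1; apply: noe.
  by exists e.
have pm : msize p = m.+1 by rewrite Ep msizeZ // (eqP p0m).
have rn : msize r = n.+1 by rewrite Er msizeZ // (eqP r0n).
have /andP[f0 e0] : (f != 0) && (e != 0).
  by rewrite -negb_or -mulf_eq0; apply: contra_eqN pm => /eqP fe0; rewrite Ef fe0 msize0.
have g0 : g != 0.
  by apply: contra_eqN rn => /eqP ge0; rewrite Eg ge0 mul0r msize0.
have sf : (0 < msize f)%N by rewrite lt0n msize_poly_eq0.
have sg : (0 < msize g)%N by rewrite lt0n msize_poly_eq0.
have se : (1 < msize e)%N.
  rewrite ltn_neqAle lt0n msize_poly_eq0 e0 andbT eq_sym.
  by apply/eqP => /mdivides_constant.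
move: pm rn; rewrite Ef Eg !msizeM // => pm rn.
exists (msize e).-1, f, g, e; rewrite !in_polys_of_deg.
move: (msize f) (msize g) (msize e) sf sg se pm rn => x y z sf sg se pm rn.
split; try lia.
by rewrite -Ef -Eg Ep Er !normclass_scale.
Qed.

(** Union bound over the degree [d] of a common factor: the factor and the two cofactors determine
    the pair of classes. *)
Lemma card_noncoprime_pairs m n :
  (#|` noncoprime_pairs m n| <= \sum_(1 <= d < (minn m n).+1)
     #|` polys_of_deg F k d| *
       (#|` polys_of_deg F k (m - d)| * #|` polys_of_deg F k (n - d)|))%N.
Proof.
pose S d := polys_of_deg F k d `*`
  (polys_of_deg F k (m - d) `*` polys_of_deg F k (n - d)).
pose im d := [fset (normclass (x.2.1 * x.1), normclass (x.2.2 * x.1)) | x in S d].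
apply: (@leq_trans #|` (\bigcup_(d <- index_iota 1 (minn m n).+1) im d)%fset|).
  apply/fsubset_leq_card/fsubsetP => -[C D]; rewrite !inE /= => /andP[/andP[CN DN]].
  move=> /asboolPn /(noncoprime_classesP CN DN)[d [f [g [e [dmn ed fd gd E]]]]].
  apply/bigfcupP; exists d; first by rewrite mem_index_iota ltnS dmn.
  by apply/imfsetP; exists (e, (f, g)) => //=; rewrite !in_fsetM /= ed fd gd.
apply: leq_trans (leq_card_bigfcup _ _) _; apply: leq_sum => d _.
by rewrite -!card_fsetM; apply: leq_imfset_card.
Qed.

End Counting.

(** * Geometric summation and the final estimate *)

Lemma leq_sum_geometric (q W N : nat) (T : nat -> nat) : (1 < q)%N ->
  (forall d, (0 < d <= N)%N -> (T d * q ^ d <= W)%N) ->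
  (\sum_(1 <= d < N.+1) T d <= W)%N.
Proof.
move=> q1 TW.
have TW2 d : (0 < d <= N)%N -> (T d * 2 ^ d <= W)%N.
  move=> dN; apply: leq_trans (TW d dN).
  by rewrite leq_mul2l leq_exp2r ?q1 ?orbT //; case/andP: dN.
(* Subtraction-free form of the bound [W * (1 - 2 ^ - M)] on the partial sum, which makes the
   induction close. *)
suff H M : (M <= N)%N -> (2 ^ M * \sum_(1 <= d < M.+1) T d + W <= 2 ^ M * W)%N.
  have t0 : (0 < 2 ^ N)%N by rewrite expn_gt0.
  by rewrite -(leq_pmul2l t0); apply: leq_trans (leq_addr W _) (H N (leqnn N)).
elim: M => [|M IH] MN; first by rewrite big_geq // muln0 mul1n.
rewrite big_nat_recr //=; have := TW2 M.+1 MN; have := IH (ltnW MN).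
rewrite expnS; set t := (2 ^ M)%N; set s := (\sum_(1 <= d < M.+1) T d)%N.
nia.
Qed.

Section Asymptotics.

Variables (F : finFieldType) (k : nat).
Local Notation q := #|F|.

(** [nmonom_growth] is spent on [n] and [nmonom_superadd] on [m]; the defect 1 of the latter is the
    leading [q] on the right. *)
Lemma common_factor_count m n d :
  (1 < k)%N -> (0 < d)%N -> (d <= m)%N -> (d <= n)%N ->
  (#|` polys_of_deg F k d| *
     (#|` polys_of_deg F k (m - d)| * #|` polys_of_deg F k (n - d)|) * q ^ (n + d)
   <= q * (q ^ #|{: 'X_{1..k < m.+1}}| * q ^ #|{: 'X_{1..k < n.+1}}|))%N.
Proof.
move=> k2 d0 dm dn.
apply: (@leq_trans (q ^ #|{: 'X_{1..k < d.+1}}| *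
    (q ^ #|{: 'X_{1..k < (m - d).+1}}| * q ^ #|{: 'X_{1..k < (n - d).+1}}|) *
    q ^ (n + d))).
  by rewrite leq_mul2r; do 2?[rewrite leq_mul ?card_polys_of_deg_le]; rewrite ?orbT.
rewrite -!expnD -expnS leq_exp2l ?card_finNzRing_gt1 //.
case: k k2 => // l l0; rewrite !card_bmultinom.
have := nmonom_superadd l d (m - d); rewrite subnKC // => ?.
have := nmonom_growth (n - d) l0 d0; rewrite subnKC // => ?.
lia.
Qed.

(** The constant is [q] from [common_factor_count] times [2 * q] for each of the two passages to
    classes. *)
Lemma card_noncoprime_pairs_le m n : (1 < k)%N ->
  (#|` noncoprime_pairs F k m n| * q ^ maxn m n
   <= 4 * q ^ 3 * (Npoly F k m * Npoly F k n))%N.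
Proof.
move=> k2; have k0 : (0 < k)%N by rewrite ltnW.
have D2N j : (q ^ #|{: 'X_{1..k < j.+1}}| <= 2 * (q * Npoly F k j))%N.
  rewrite (leq_trans (card_polys_of_deg_ge _ _ k0)) // leq_mul2l.
  exact: card_polys_of_deg_normpolys.
apply: (@leq_trans (q * (q ^ #|{: 'X_{1..k < m.+1}}| *
    q ^ #|{: 'X_{1..k < n.+1}}|))); last first.
  apply: leq_trans (leq_mul (leqnn q) (leq_mul (D2N m) (D2N n))) _.
  by apply: eq_leq; ring.
apply: leq_trans (leq_mul (card_noncoprime_pairs F k m n) (leqnn _)) _.
rewrite big_distrl /=.
apply: (leq_sum_geometric (card_finNzRing_gt1 F)) => d /andP[d0].
rewrite leq_min -mulnA -(expnD q (maxn m n) d) => /andP[dm dn].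
(* The growth must be spent on the larger degree, so the two roles are swapped when [n < m]. *)
case: (leqP m n) => _; first exact: common_factor_count.
rewrite [X in (_ * X * _ <= _)%N]mulnC [X in (_ <= q * X)%N]mulnC.
exact: common_factor_count.
Qed.

End Asymptotics.

Theorem theorem4p1 (R : realType) (F : finFieldType) (k : nat) (hk : (2 <= k)%N)
    (eps : R) (heps : 0 < eps) :
  exists M : nat, forall m n : nat, (M <= m + n)%N ->
    `| (Pcoprime F k m n)%:R / ((Npoly F k m)%:R * (Npoly F k n)%:R) - 1 | < eps.
Proof.
have q1 : (1 < #|F|)%N by exact: card_finNzRing_gt1.
(* Once [q ^ maxn m n] exceeds [c], the proportion of non-coprime pairs is below [eps]. *)
pose c : R := (4 * #|F| ^ 3)%:R / eps.
have c0 : 0 <= c by rewrite divr_ge0 ?ler0n // ltW.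
pose K := Num.bound c.
(* A sum of at least [2 * K] forces [maxn m n] to be at least [K]. *)
exists (2 * K)%N => m n Kmn.
have NN0 : (0 < Npoly F k m * Npoly F k n)%N.
  by rewrite muln_gt0 !Npoly_gt0 // ltnW.
have NN0' : 0 < (Npoly F k m)%:R * (Npoly F k n)%:R :> R by rewrite -natrM ltr0n.
have -> : (Pcoprime F k m n)%:R / ((Npoly F k m)%:R * (Npoly F k n)%:R) - 1 =
    - (#|` noncoprime_pairs F k m n|%:R /
       ((Npoly F k m)%:R * (Npoly F k n)%:R)) :> R.
  rewrite -natrM -Pcoprime_compl -[X in _ - X](@divff _
    ((Pcoprime F k m n + #|` noncoprime_pairs F k m n|)%:R)).
    by rewrite -mulrBl natrD opprD addNKr mulNr.
  by rewrite Pcoprime_compl pnatr_eq0 -lt0n.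
rewrite normrN ger0_norm ?divr_ge0 ?ler0n ?(ltW NN0') // ltr_pdivrMr //.
have cK : c < (#|F| ^ maxn m n)%:R.
  apply: (lt_le_trans (archi_boundP c0)); rewrite ler_nat -/K.
  apply: leq_trans (ltnW (ltn_expl (maxn m n) q1)); lia.
rewrite -(ltr_pM2r (le_lt_trans c0 cK)).
apply: (@le_lt_trans _ _
  (4 * #|F| ^ 3 * (Npoly F k m * Npoly F k n))%:R).
  by rewrite -natrM ler_nat card_noncoprime_pairs_le.
rewrite mulrAC natrM [X in _ * X < _]natrM ltr_pM2r //.
rewrite -ltr_pdivrMl // [X in X < _]mulrC.
exact: cK.
Qed.
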